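(* Consider the series $\sum c_n a_n$ with $\{a_n\}$ and $\{c_n\}$ sequences of positive real numbers. (i) Suppose that there exist a sequence $\{q_n\}$ and a positive integer $N$ for which $$q_n\frac{a_n}{a_{n+1}}-q_{n+1}\leq -c_{n+1}, \qquad n\geq N,$$ with $\sum \frac{1}{q_n}$ being a divergent series. Then $\sum a_n$, $\sum \frac{1}{c_n}$, $\sum (q_n-c_n)a_n$ and $\sum q_n a_n$ diverge. If, in addition, $\sum \frac{c_n}{q_n}$ diverges, then $\sum c_n a_n$ diverges. (ii) Suppose that both series $\sum c_n a_n$ and $\sum a_n$ diverge. Also, suppose that for every $m\in\mathbb{N}$ there exists $r\geq m$, $r\in\mathbb{N}$, such that $$a_m+\dots+a_r\geq c_m a_m+\dots+c_r a_r.$$ Then there exist a sequence $\{q_n\}$ and a positive integer $N\geq 1$ such that $\sum\frac{1}{q_n}$ diverges and $$q_n\frac{a_n}{a_{n+1}}-q_{n+1}\leq -c_{n+1}, \qquad n\geq N.$$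
   Context: $\mathbb{N}$ denotes the set of positive integers; all sequences are sequences of real numbers indexed by the positive integers.
   Formalization: ''∑1/q_n divergent'' is read as divergent to +∞ (in (i) and (ii)), with q_n ≠ 0; with divergence to −∞ allowed, (i) fails: a_n = 2^(-n), c_n = 1, q_n = -1 satisfies the inequality, but ∑a_n converges. *)

(* Defs.v *)
From Stdlib Require Import Reals.
From Coquelicot Require Import Coquelicot.
Open Scope R_scope.

(* A sequence indexed by the positive integers is a function on [nat] whose
   value at 0 is never used; a series starts with the term of index 1. *)
Definition diverges (u : nat -> R) : Prop :=
  ~ ex_series (fun n => u (S n)).

(* The sense of divergence used for the series of the 1 / q n.  The sign of q is
   not prescribed, and mere non-convergence would not do: for a n = / 2 ^ n,
   c n = 1, q n = - 1 the inequality holds and the series of the 1 / q n tends to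
   minus infinity, but the series of the a n converges.  For q positive it
   is equivalent to [diverges]. *)
Definition diverges_to_infty (u : nat -> R) : Prop :=
  is_lim_seq (sum_n (fun n => u (S n))) p_infty.

(* Main.v *)
Require Import Defs.
From Stdlib Require Import Reals Lra Lia Classical.
From Coquelicot Require Import Coquelicot.
Open Scope R_scope.

(** Multiplied by [a (S n)], the inequality on [q] says that
    [p n := q n * a n] satisfies [p n + c (S n) * a (S n) <= p (S n)] from [N] on;
    the whole theorem is about this increasing sequence.

    In part (i), the partial sums of [1 / q n] tend to plus infinity, so [q], and
    hence [p], is positive at some index beyond [N]; being increasing, [p] then
    stays above a constant [B > 0] ([eventually_bounded_below]).  From
    [a n = p n / q n >= B / q n], [c n * a n >= B * (c n / q n)] and
    [1 / c n >= 1 / q n], every claim becomes a comparison with the constant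
    series, the series of the [1 / q n] or that of the [c n / q n]
    ([diverges_compare]).

    In part (ii), a sequence for which the inequality is an equality will do:
    take for [p n] the partial sum [S_n] of the series of the [c n * a n], that
    is, [q n = S_n / a n].  What remains is that the series of the [a n / S_n]
    diverges, a variant of the Abel-Dini theorem ([abel_dini_dominated]).  The
    intervals on which the sum of [a] is at least that of [c * a] can be
    concatenated, so from every start [m] there are arbitrarily long ones; on
    such an interval the sum of the [a n / S_n] is at least
    [(S_r - S_(m-1)) / S_r], which is at least [1/2] once [S_r >= 2 * S_(m-1)].
    So the Cauchy criterion fails. *)

(** * Divergence and comparison *)

Lemma diverges_compare (u v : nat -> R) (C : R) (M : nat) :
  (forall n, (M <= n)%nat -> Rabs (u n) <= C * v n) ->
  diverges u -> diverges v.
Proof.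
intros H Hu Hv; apply Hu.
apply (ex_series_incr_n (V := R_NormedModule) _ M).
apply (ex_series_le (V := R_CompleteNormedModule) _ (fun k => C * v (S (M + k)))).
- intros k; apply H; lia.
- apply (ex_series_scal_l (V := R_NormedModule) C (fun k => v (S (M + k)))).
  now apply (ex_series_incr_n (V := R_NormedModule) (fun n => v (S n)) M).
Qed.

Lemma diverges_const_1 : diverges (fun _ => 1).
Proof.
intros H; apply ex_series_lim_0 in H; apply is_lim_seq_unique in H.
rewrite Lim_seq_const in H; injection H; lra.
Qed.

Lemma diverges_to_infty_diverges (u : nat -> R) :
  diverges_to_infty u -> diverges u.
Proof.
intros Hu [l Hl].
change (is_lim_seq (sum_n (fun n => u (S n))) l) in Hl.
apply is_lim_seq_unique in Hl; apply is_lim_seq_unique in Hu.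
rewrite Hl in Hu; discriminate.
Qed.

Lemma nonneg_diverges_to_infty (u : nat -> R) :
  (forall n, (1 <= n)%nat -> 0 <= u n) -> diverges u -> diverges_to_infty u.
Proof.
intros Hpos Hu.
assert (Hinc : forall n, sum_n (fun n => u (S n)) n <= sum_n (fun n => u (S n)) (S n)).
{ intros n; rewrite sum_Sn; unfold plus; simpl.
  assert (H := Hpos (S (S n)) ltac:(lia)); lra. }
destruct (ex_lim_seq_incr _ Hinc) as [[l | |] Hl].
- now destruct Hu; exists l.
- exact Hl.
- apply is_lim_seq_spec in Hl.
  destruct (Hl (sum_n (fun n => u (S n)) 0)) as [K HK].
  assert (H : sum_n (fun n => u (S n)) 0 <= sum_n (fun n => u (S n)) K).
  { clear HK; induction K as [| K IH]; [lra | specialize (Hinc K); lra]. }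
  specialize (HK K (le_n K)); simpl in HK; lra.
Qed.

Lemma diverges_to_infty_pos_term (u : nat -> R) (N : nat) :
  diverges_to_infty u -> exists n, (N <= n)%nat /\ 0 < u n.
Proof.
intros Hu; apply NNPP; intros Hno.
assert (Hneg : forall n, (N <= n)%nat -> u n <= 0).
{ intros n Hn; apply Rnot_lt_le; intros Hlt; apply Hno; now exists n. }
apply is_lim_seq_spec in Hu.
destruct (Hu (sum_n (fun n => u (S n)) N)) as [K HK].
assert (H : forall k, sum_n (fun n => u (S n)) (k + N) <= sum_n (fun n => u (S n)) N).
{ induction k as [| k IH]; [apply Rle_refl |].
  change (S k + N)%nat with (S (k + N)); rewrite sum_Sn; unfold plus; simpl.
  assert (H := Hneg (S (S (k + N))) ltac:(lia)); lra. }
specialize (HK (K + N)%nat ltac:(lia)); specialize (H K); simpl in HK; lra.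
Qed.

(** * Sums over intervals *)

Lemma sum_n_m_le_range (u v : nat -> R) (m r : nat) :
  (m <= r)%nat -> (forall k, (m <= k <= r)%nat -> u k <= v k) ->
  sum_n_m u m r <= sum_n_m v m r.
Proof.
induction 1 as [| r Hmr IH]; intros H.
- rewrite !sum_n_n; apply H; lia.
- rewrite !sum_n_Sm by lia.
  apply Rplus_le_compat; [apply IH; intros k Hk |]; apply H; lia.
Qed.

Lemma sum_n_m_split (u : nat -> R) (n m k : nat) :
  (n <= S m)%nat -> (m <= k)%nat ->
  sum_n_m u n k = sum_n_m u n m + sum_n_m u (S m) k.
Proof. exact (sum_n_m_Chasles u n m k). Qed.

Lemma sum_n_m_nonneg (u : nat -> R) (m r : nat) :
  (forall k, (m <= k)%nat -> 0 <= u k) -> 0 <= sum_n_m u m r.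
Proof.
intros H; destruct (Nat.le_gt_cases m r) as [Hmr | Hrm].
- rewrite <- (Rmult_0_r (INR (S r - m))), <- (sum_n_m_const m r 0).
  apply sum_n_m_le_range; [exact Hmr | intros k Hk; apply H; lia].
- rewrite sum_n_m_zero by exact Hrm; apply Rle_refl.
Qed.

Lemma partial_sum_pos (u : nat -> R) (n : nat) :
  (forall k, (1 <= k)%nat -> 0 < u k) -> (1 <= n)%nat -> 0 < sum_n_m u 1 n.
Proof.
intros Hu Hn; rewrite (sum_n_m_split u 1 1 n), sum_n_n by lia.
assert (H := Hu 1%nat (le_n 1)).
assert (0 <= sum_n_m u 2 n); [| lra].
apply sum_n_m_nonneg; intros k Hk; apply Rlt_le, Hu; lia.
Qed.

(** * A dominated Abel-Dini theorem *)

(** Consecutive dominated intervals concatenate, so dominated intervals that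
    start at [m] can be prolonged beyond any [K]. *)
Lemma domination_arbitrarily_long (a b : nat -> R) :
  (forall m, (1 <= m)%nat ->
     exists r, (m <= r)%nat /\ sum_n_m a m r >= sum_n_m b m r) ->
  forall m K, (1 <= m)%nat ->
    exists r, (m <= r)%nat /\ (K <= r)%nat /\ sum_n_m a m r >= sum_n_m b m r.
Proof.
intros H m K Hm; induction K as [| K (r & Hmr & HKr & Hr)].
- destruct (H m Hm) as (r & Hmr & Hr); exists r; split; [exact Hmr | split; [lia | exact Hr]].
- destruct (H (S r) ltac:(lia)) as (s & Hrs & Hs).
  exists s; split; [lia | split; [lia |]].
  rewrite (sum_n_m_split a m r s), (sum_n_m_split b m r s) by lia; lra.
Qed.

(** For [a = b] this is the Abel-Dini theorem on the series of the terms divided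
    by their partial sums.  With [S_n] the partial sums of [b], an interval from [m]
    to [r] on which [a] dominates gives
    [sum a_n / S_n >= (sum a_n) / S_r >= (S_r - S_(m-1)) / S_r], and this is at
    least [1/2] for large [r] because [S_r] tends to infinity. *)
Lemma abel_dini_dominated (a b : nat -> R) :
  (forall n, (1 <= n)%nat -> 0 < a n) ->
  (forall n, (1 <= n)%nat -> 0 < b n) ->
  diverges b ->
  (forall m, (1 <= m)%nat ->
     exists r, (m <= r)%nat /\ sum_n_m a m r >= sum_n_m b m r) ->
  diverges (fun n => a n / sum_n_m b 1 n).
Proof.
intros Ha Hb Hdiv Hdom Hcv.
assert (Hpos : forall n, (1 <= n)%nat -> 0 < sum_n_m b 1 n).
{ intros n; now apply partial_sum_pos. }
destruct (Cauchy_ex_series (V := R_CompleteNormedModule) _ Hcv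
            (mkposreal (/ 2) ltac:(lra))) as [N HN].
assert (Hinf : diverges_to_infty b).
{ apply nonneg_diverges_to_infty; [intros n Hn; now apply Rlt_le, Hb | exact Hdiv]. }
apply is_lim_seq_spec in Hinf.
destruct (Hinf (2 * sum_n_m b 1 N)) as [K HK].
destruct (domination_arbitrarily_long a b Hdom (S N) (S K) ltac:(lia))
  as (r & HNr & HKr & Hr).
destruct r as [| r]; [lia |].
specialize (HK r ltac:(lia)); unfold sum_n in HK; rewrite sum_n_m_S in HK.
specialize (HN N r ltac:(lia) ltac:(lia)); simpl in HN.
rewrite (sum_n_m_S (fun n => a n / sum_n_m b 1 n)) in HN.
apply Rabs_lt_between in HN.
assert (Hsplit := sum_n_m_split b 1 N (S r) ltac:(lia) ltac:(lia)).
assert (HPr := Hpos (S r) ltac:(lia)).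
set (P := sum_n_m b 1 (S r)) in *.
assert (Hle : / P * sum_n_m a (S N) (S r)
              <= sum_n_m (fun n => a n / sum_n_m b 1 n) (S N) (S r)).
{ apply Rle_trans with (sum_n_m (fun n => / P * a n) (S N) (S r)).
  { apply Req_le; symmetry; exact (sum_n_m_mult_l (K := R_Ring) (/ P) a (S N) (S r)). }
  apply sum_n_m_le_range; [exact HNr |].
  intros k Hk; rewrite Rmult_comm.
  apply Rmult_le_compat_l; [apply Rlt_le, Ha; lia |].
  apply Rinv_le_contravar; [apply Hpos; lia |].
  unfold P; rewrite (sum_n_m_split b 1 k (S r)) by lia.
  assert (0 <= sum_n_m b (S k) (S r)); [| lra].
  apply sum_n_m_nonneg; intros i Hi; apply Rlt_le, Hb; lia. }
assert (Hhalf : / P * (P / 2) <= / P * sum_n_m a (S N) (S r)).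
{ apply Rmult_le_compat_l; [now apply Rlt_le, Rinv_0_lt_compat | lra]. }
replace (/ P * (P / 2)) with (/ 2) in Hhalf by (field; lra).
lra.
Qed.

(** * The increasing sequence of part (i) *)

(** Divergence to plus infinity makes [q n * a n] positive at some index beyond
    [N]; that value serves as [B], because the sequence increases from there on.
    The bound is stated for [(q n - c n) * a n] since the inequality makes it at
    least the previous value of [q n * a n]; the same bound for [q n * a n]
    and the comparison [c n < q n] follow from it. *)
Lemma eventually_bounded_below (a c q : nat -> R) (N : nat) :
  (1 <= N)%nat ->
  (forall n, (1 <= n)%nat -> 0 < a n) ->
  (forall n, (1 <= n)%nat -> 0 < c n) ->
  (forall n, (N <= n)%nat -> q n * (a n / a (S n)) - q (S n) <= - c (S n)) ->
  diverges_to_infty (fun n => 1 / q n) ->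
  exists (B : R) (M : nat), 0 < B /\ (1 <= M)%nat /\
    forall n, (M <= n)%nat -> B <= (q n - c n) * a n.
Proof.
intros HN Ha Hc Hq Hinf.
assert (Hstep : forall n, (N <= n)%nat -> q n * a n <= (q (S n) - c (S n)) * a (S n)).
{ intros n Hn.
  assert (H := Ha (S n) ltac:(lia)).
  replace (q n * a n) with (q n * (a n / a (S n)) * a (S n)) by (field; lra).
  apply Rmult_le_compat_r; [lra |].
  specialize (Hq n Hn); lra. }
destruct (diverges_to_infty_pos_term _ N Hinf) as (M & HNM & HM).
assert (HqM : 0 < q M).
{ unfold Rdiv in HM; rewrite Rmult_1_l in HM.
  rewrite <- (Rinv_inv (q M)); now apply Rinv_0_lt_compat. }
assert (Hincr : forall k, q M * a M <= q (k + M)%nat * a (k + M)%nat).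
{ induction k as [| k IH]; [apply Rle_refl |].
  assert (H := Hstep (k + M)%nat ltac:(lia)).
  assert (Hca := Rmult_lt_0_compat _ _ (Hc (S (k + M)) ltac:(lia)) (Ha (S (k + M)) ltac:(lia))).
  change (S k + M)%nat with (S (k + M)); lra. }
exists (q M * a M), (S M); split; [| split; [lia |]].
- apply Rmult_lt_0_compat; [exact HqM | apply Ha; lia].
- intros n Hn.
  destruct n as [| n]; [lia |].
  specialize (Hincr (n - M)%nat); replace (n - M + M)%nat with n in Hincr by lia.
  specialize (Hstep n ltac:(lia)); lra.
Qed.

(** * Both implications *)

Theorem theorem3p2 (a c : nat -> R)
  (ha : forall n : nat, (1 <= n)%nat -> 0 < a n)
  (hc : forall n : nat, (1 <= n)%nat -> 0 < c n) :
  (forall (q : nat -> R) (N : nat),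
      (1 <= N)%nat ->
      (forall n : nat, (1 <= n)%nat -> q n <> 0) ->
      (forall n : nat, (N <= n)%nat ->
         q n * (a n / a (S n)) - q (S n) <= - c (S n)) ->
      diverges_to_infty (fun n => 1 / q n) ->
      (diverges a /\
       diverges (fun n => 1 / c n) /\
       diverges (fun n => (q n - c n) * a n) /\
       diverges (fun n => q n * a n)) /\
      (diverges (fun n => c n / q n) -> diverges (fun n => c n * a n)))
  /\
  (diverges (fun n => c n * a n) ->
   diverges a ->
   (forall m : nat, (1 <= m)%nat ->
      exists r : nat, (m <= r)%nat /\
        sum_n_m a m r >= sum_n_m (fun k => c k * a k) m r) ->
   exists (q : nat -> R) (N : nat),
     (1 <= N)%nat /\
     (forall n : nat, (1 <= n)%nat -> q n <> 0) /\
     diverges_to_infty (fun n => 1 / q n) /\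
     (forall n : nat, (N <= n)%nat ->
        q n * (a n / a (S n)) - q (S n) <= - c (S n))).
Proof.
split.
- intros q N HN _ Hq Hinf.
  destruct (eventually_bounded_below a c q N HN ha hc Hq Hinf) as (B & M & HB & HM & Hlow).
  assert (Hqc : forall n, (M <= n)%nat -> c n < q n).
  { intros n Hn; specialize (Hlow n Hn); assert (Han := ha n ltac:(lia)).
    apply Rnot_le_lt; intros H; nra. }
  assert (Hqa : forall n, (M <= n)%nat -> B <= q n * a n).
  { intros n Hn; specialize (Hlow n Hn).
    assert (H := Rmult_lt_0_compat _ _ (hc n ltac:(lia)) (ha n ltac:(lia))); lra. }
  assert (Hdiv := diverges_to_infty_diverges _ Hinf).
  assert (Ha_low : forall n, (M <= n)%nat -> 1 / q n <= / B * a n).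
  { intros n Hn; specialize (Hqa n Hn); specialize (Hqc n Hn).
    assert (H := hc n ltac:(lia)).
    replace (1 / q n) with (B * (/ B * / q n)) by (field; lra).
    replace (/ B * a n) with (q n * a n * (/ B * / q n)) by (field; lra).
    apply Rmult_le_compat_r; [| exact Hqa].
    apply Rlt_le, Rmult_lt_0_compat; apply Rinv_0_lt_compat; lra. }
  assert (Hconst : forall v, (forall n, (M <= n)%nat -> B <= v n) -> diverges v).
  { intros v Hv; apply (diverges_compare (fun _ => 1) v (/ B) M); [| exact diverges_const_1].
    intros n Hn; rewrite Rabs_R1, <- (Rinv_l B) by lra.
    apply Rmult_le_compat_l; [now apply Rlt_le, Rinv_0_lt_compat | now apply Hv]. }
  assert (Hinvq : forall n, (M <= n)%nat -> 0 < 1 / q n).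
  { intros n Hn; specialize (Hqc n Hn); assert (H := hc n ltac:(lia)).
    apply Rdiv_lt_0_compat; lra. }
  split; [split; [| split; [| split]] |].
  + apply (diverges_compare (fun n => 1 / q n) a (/ B) M); [| exact Hdiv].
    intros n Hn; rewrite Rabs_pos_eq by now apply Rlt_le, Hinvq.
    now apply Ha_low.
  + apply (diverges_compare (fun n => 1 / q n) _ 1 M); [| exact Hdiv].
    intros n Hn; rewrite Rabs_pos_eq by now apply Rlt_le, Hinvq.
    unfold Rdiv; rewrite !Rmult_1_l.
    apply Rinv_le_contravar; [apply hc; lia | now apply Rlt_le, Hqc].
  + now apply Hconst.
  + now apply Hconst.
  + apply (diverges_compare (fun n => c n / q n) _ (/ B) M).
    intros n Hn.
    assert (Hcn := hc n ltac:(lia)); specialize (Ha_low n Hn); specialize (Hinvq n Hn).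
    replace (c n / q n) with (c n * (1 / q n)) by (unfold Rdiv; ring).
    rewrite Rabs_pos_eq by now apply Rlt_le, Rmult_lt_0_compat.
    replace (/ B * (c n * a n)) with (c n * (/ B * a n)) by ring.
    apply Rmult_le_compat_l; [lra | exact Ha_low].
- intros Hdiv _ Hdom.
  set (b := fun k => c k * a k) in *.
  assert (Hb : forall n, (1 <= n)%nat -> 0 < b n).
  { intros n Hn; apply Rmult_lt_0_compat; [now apply hc | now apply ha]. }
  assert (HP : forall n, (1 <= n)%nat -> 0 < sum_n_m b 1 n).
  { intros n; now apply partial_sum_pos. }
  assert (Hq : forall n, (1 <= n)%nat -> 0 < sum_n_m b 1 n / a n).
  { intros n Hn; apply Rdiv_lt_0_compat; [now apply HP | now apply ha]. }
  exists (fun n => sum_n_m b 1 n / a n), 1%nat.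
  split; [lia | split; [| split]].
  + intros n Hn; apply Rgt_not_eq, Hq, Hn.
  + apply nonneg_diverges_to_infty.
    * intros n Hn; apply Rlt_le, Rdiv_lt_0_compat; [lra | now apply Hq].
    * apply (diverges_compare (fun n => a n / sum_n_m b 1 n) _ 1 1);
        [| now apply abel_dini_dominated].
      intros n Hn; assert (H := HP n Hn); assert (Han := ha n Hn).
      rewrite Rabs_pos_eq by now apply Rlt_le, Rdiv_lt_0_compat.
      apply Req_le; field; lra.
  + intros n Hn; rewrite sum_n_Sm by lia; unfold plus; simpl.
    assert (Han := ha n Hn); assert (HSn := ha (S n) ltac:(lia)).
    apply Req_le; unfold b at 3; field; lra.
Qed.
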